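(* Let $N_{\mu,\sigma}$ be a Gaussian random variable with mean $\mu\in\mathbb{R}$ and variance $\sigma^2$, where $\sigma>0$. Then for every real $y>0$, $$\mathbf{P}\left(|N_{\mu,\sigma}-\mu|\ge y\sigma\right)=2\Phi(-y),$$ where $\Phi$ is the cumulative distribution function of the standard normal distribution.
   Context: $\mathbf{P}$ denotes probability. *)

(* Defs.v *)
From HB Require Import structures.
From mathcomp Require Import all_boot all_order all_algebra.
From mathcomp Require Import all_classical all_reals all_analysis.
Set Implicit Arguments.
Unset Strict Implicit.
Unset Printing Implicit Defensive.
Import Order.TTheory GRing.Theory Num.Theory.
Import numFieldNormedType.Exports.
Local Open Scope classical_set_scope.
Local Open Scope ring_scope.

(* normal_prob is parametrized by the standard deviation, so sigma below is
   not the variance; for sigma = 0 it is the uniform law on [0, 1] (library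
   convention), hence this is meant to be used with 0 < sigma. *)
Definition gaussian (d : measure_display) (T : measurableType d)
    (R : realType) (P : probability T R) (X : {RV P >-> R}) (mu sigma : R) :=
  forall A : set R, measurable A -> distribution P X A = normal_prob mu sigma A.

(* cdf takes a random variable, not a law: Phi is the cdf of the identity on
   the real line equipped with the standard normal law. *)
Definition idR (R : realType) : measurableTypeR R -> R := idfun.

HB.instance Definition _ (R : realType) :=
  @isMeasurableFun.Build _ _ _ _ (@idR R) (@measurable_id _ _ setT).

Definition Phi (R : realType) : R -> \bar R :=
  cdf (@idR R : {RV (normal_prob (0 : R) 1) >-> R}).

(* Main.v *)
Require Import Defs.
From HB Require Import structures.
From mathcomp Require Import all_boot all_order all_algebra.
From mathcomp Require Import all_classical all_reals all_analysis.
From mathcomp Require Import ring lra.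
Set Implicit Arguments.
Unset Strict Implicit.
Unset Printing Implicit Defensive.
Import Order.TTheory GRing.Theory Num.Theory.
Import numFieldNormedType.Exports.
Local Open Scope classical_set_scope.
Local Open Scope ring_scope.

(** The event splits into the two tails N <= mu - y * sigma and
    N >= mu + y * sigma, disjoint because y * sigma > 0. The normal density
    is symmetric about mu, so both tails have the same mass
    ([normal_prob_reflect]), and the affine substitution
    x |-> (x - mu) / sigma turns the mass of the left one into the value
    Phi (- y) of the standard cumulative distribution function
    ([normal_prob_standardize]). *)

(** The constant slope makes all the conditions on the derivative in the
    substitution theorems immediate. *)
Lemma derive1_affine (R : realType) (c b : R) :
  (fun x : R => (x - c) * b)^`()%classic = cst b.
Proof.
apply/funext => x.
rewrite derive1E deriveM// deriveB// derive_id !derive_cst.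
by rewrite scaler0 add0r subr0 /GRing.scale/= mulr1.
Qed.

Lemma continuous_affine (R : realType) (c b : R) :
  continuous (fun x : R => (x - c) * b).
Proof.
move=> x; apply: cvgM; last exact: cvg_cst.
by apply: cvgB; [exact: cvg_id|exact: cvg_cst].
Qed.

(** The Jacobian 1 / s of the substitution is exactly the ratio of the
    normalising constants of the two densities. *)
Lemma normal_pdf_standardize (R : realType) (m s x : R) : 0 < s ->
  normal_pdf 0 1 ((x - m) * s^-1) * s^-1 = normal_pdf m s x.
Proof.
move=> s0; rewrite !normal_pdfE ?oner_neq0 ?gt_eqF//.
rewrite /normal_peak /normal_fun -mulrA (mulrC (expR _)) mulrA; congr *%R.
  rewrite -!mulrnAr expr1n mul1r sqrtrM ?sqr_ge0// sqrtr_sqr gtr0_norm//.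
  by rewrite invfM mulrC.
congr expR; field; exact: lt0r_neq0.
Qed.

Lemma normal_prob_standardize (R : realType) (m s z : R) : 0 < s ->
  normal_prob m s `]-oo, m + z * s] = Phi z.
Proof.
move=> s0; have s0' : 0 < s^-1 by rewrite invr_gt0.
pose F (x : R) := (x - m) * s^-1.
have Fz : F (m + z * s) = z.
  by rewrite /F addrC addKr mulfK// gt_eqF.
rewrite /Phi /cdf /distribution /pushforward/= preimage_id /normal_prob.
rewrite -[in RHS]Fz (@increasing_ge0_integration_by_substitutionNy _ F)//.
- apply: eq_integral => x _; congr EFin.
  by rewrite fctE/= derive1_affine normal_pdf_standardize.
- by move=> x y _ _ xy; rewrite /F ltr_pM2r// ltrD2r.
- by rewrite derive1_affine => x _; exact: cvg_cst.
- by rewrite derive1_affine; exact: is_cvg_cst.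
- by rewrite derive1_affine; exact: cvg_cst.
- split; first by move=> x _; exact: derivableM.
  by apply: cvg_at_left_filter; exact: continuous_affine.
- by apply: gt0_cvgMlNy => //; exact: cvg_addrr_Ny.
- apply: continuous_subspaceT; apply: continuous_normal_pdf.
  exact: oner_neq0.
- by move=> x _; exact: normal_pdf_ge0.
Qed.

Lemma normal_prob_reflect (R : realType) (m s a : R) : s != 0 ->
  normal_prob m s `]-oo, m - a] = normal_prob m s `[m + a, +oo[.
Proof.
move=> s0.
(* The reflection x |-> 2 m - x, in the shape that [derive1_affine] expects. *)
pose F (x : R) := (x - m *+ 2) * -1.
have Fa : F (m + a) = m - a by rewrite /F; ring.
rewrite /normal_prob -Fa (@decreasing_ge0_integration_by_substitutiony _ F)//.
- apply: eq_integral => x _; congr EFin.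
  rewrite !fctE/= derive1_affine /= opprK mulr1 !normal_pdfE// /normal_fun.
  by have -> : (F x - m) ^+ 2 = (x - m) ^+ 2 by rewrite /F; ring.
- by move=> x y _ _ xy; rewrite /F !mulrN1 ltrN2 ltrD2r.
- by rewrite derive1_affine => x _; exact: cvg_cst.
- by rewrite derive1_affine; exact: is_cvg_cst.
- by rewrite derive1_affine; exact: is_cvg_cst.
- split; first by move=> x _; exact: derivableM.
  by apply: cvg_at_right_filter; exact: continuous_affine.
- rewrite /F; under eq_fun do rewrite mulrN1.
  by apply/cvgNrNy; exact: cvg_addrr.
- by apply: continuous_subspaceT; exact: continuous_normal_pdf.
- by move=> x _; exact: normal_pdf_ge0.
Qed.

Theorem proposition2p3 (R : realType) (d : measure_display)
    (T : measurableType d) (P : probability T R) (N : {RV P >-> R})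
    (mu sigma : R) (sigma_gt0 : 0 < sigma) (N_gaussian : gaussian N mu sigma)
    (y : R) (y_gt0 : 0 < y) :
  (P [set t | (y * sigma <= `|N t - mu|)%R] = 2%:E * Phi (- y)%R)%E.
Proof.
have ys0 : 0 < y * sigma by exact: mulr_gt0.
have -> : [set t | y * sigma <= `|N t - mu|] =
    N @^-1` (`]-oo, mu - y * sigma] `|` `[mu + y * sigma, +oo[).
  apply/seteqP; split => t /=; rewrite !in_itv/= andbT ler_normr.
    by move=> /orP[h|h]; [right|left]; lra.
  by move=> [h|h]; apply/orP; [right|left]; lra.
rewrite [LHS]N_gaussian; last by apply: measurableU; exact: measurable_itv.
rewrite measureU//=; last first.
  by apply/seteqP; split => // x /=; rewrite !in_itv/= andbT => -[? ?]; lra.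
rewrite -normal_prob_reflect ?gt_eqF// -mulNr normal_prob_standardize//.
by rewrite -mule2n -mule_natl.
Qed.
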